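(* Let $S$ be a real quadratic space of signature $(1,r)$, $r\ge0$, with quadratic form $q_S$ and bilinear form $(x,y)_S=q_S(x+y)-q_S(x)-q_S(y)$, a fixed $1_S\in S$ with $q_S(1_S)=1$, and the involution $\iota_S$ with $\iota_S(1_S)=1_S$ and $\iota_S=-\mathrm{Id}$ on $1_S^\perp$. Let $J=\mathbb{R}\times S$ with $N((\beta,t))=\beta q_S(t)$, $(\beta,t)^\#=(q_S(t),\beta\iota_S(t))$, $1_J=(1,1_S)$, and $((\beta,t),(\beta',t'))_J=\beta\beta'+(t,\iota_S(t'))_S$. Then $J$ is a cubic norm structure. Furthermore, let $V=\mathbb{R}\oplus S\oplus\mathbb{R}$ with $q_V((\alpha,s,\beta))=\alpha\beta-q_S(s)$ and $(x,y)_V=q_V(x+y)-q_V(x)-q_V(y)$, let $V_2=\mathbb{R}e\oplus\mathbb{R}f$ with symplectic form $\langle e,f\rangle=1$, and identify $V_2\otimes V$ with $W_J=\mathbb{R}\oplus J\oplus J\oplus\mathbb{R}$ via \[e\otimes(\alpha,s,\beta)+f\otimes(\gamma,t,\delta)\mapsto(\alpha,(\gamma,s),(\beta,\iota_S(t)),\delta).\] Under this identification, the symplectic form $\langle v\otimes x,v'\otimes x'\rangle=\langle v,v'\rangle(x,x')_V$ and the quartic form $Q(e\otimes x+f\otimes y)=(x,y)_V^2-4q_V(x)q_V(y)$ on $V_2\otimes V$ coincide with Freudenthal's symplectic form $\langle(a,b,c,d),(a',b',c',d')\rangle=ad'-(b,c')+(c,b')-da'$ and quartic form $q((a,b,c,d))=(ad-(b,c))^2+4aN(c)+4dN(b)-4(b^\#,c^\#)$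 on $W_J$ (with $(\,,\,)=(\,,\,)_J$).
   Context: A cubic norm structure over $\mathbb{R}$ is a finite-dimensional vector space $J$ with a cubic polynomial $N$, a quadratic map $\#$, an element $1_J$ and a symmetric bilinear form $(\,,\,)$ such that, with $x\times y=(x+y)^\#-x^\#-y^\#$ and $(\,,\,,\,)$ the symmetric trilinear form with $(x,x,x)=6N(x)$: $N(1_J)=1$, $1_J^\#=1_J$, $1_J\times x=(1_J,x)1_J-x$, $(x^\#)^\#=N(x)x$, $(x,y)=(1_J,1_J,x)(1_J,1_J,y)-(1_J,x,y)$, and $N(x+y)=N(x)+(x^\#,y)+(x,y^\#)+N(y)$ for all $x,y$.
   Formalization: In the definition of a cubic norm structure the pairing axiom reads (x,y) = (1/4)(1_J,1_J,x)(1_J,1_J,y) − (1_J,x,y); without the factor 1/4 the axioms clash at x=y=1_J (30 versus 3), so no such structure exists. *)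

(* Defs.v *)
From HB Require Import structures.
From mathcomp Require Import all_boot all_order all_algebra reals.
From mathcomp Require Import mpoly.

Set Implicit Arguments.
Unset Strict Implicit.
Unset Printing Implicit Defensive.

Import Order.TTheory GRing.Theory Num.Theory.
Local Open Scope ring_scope.

Definition polar (U V : zmodType) (q : U -> V) (x y : U) : V :=
  q (x + y) - q x - q y.

Definition quadratic_map (R : comNzRingType) (U V : lmodType R)
    (q : U -> V) : Prop :=
  (forall (a : R) (x : U), q (a *: x) = a ^+ 2 *: q x) /\
  bilinear_for *:%R *:%R (polar q).

(* The coordinates are taken in the basis [vbasis {:U}]; changing the basis is
   a linear substitution, so the notion does not depend on this choice.  The
   zero function is homogeneous of every degree. *)
Definition homogeneous_polynomial (R : fieldType) (U : vectType R) (d : nat)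
    (F : U -> R) : Prop :=
  exists2 p : {mpoly R[\dim {:U}]}, p \is d.-homog &
    forall x : U, F x = p.@[fun i => coord (vbasis {:U}) i x].

Definition has_signature (R : realType) (U : vectType R) (q : U -> R)
    (p n : nat) : Prop :=
  exists e : (p + n).-tuple U,
    [/\ basis_of {:U} e,
        forall i j, i != j -> polar q (tnth e i) (tnth e j) = 0
      & forall i : 'I_(p + n),
          if (i < p)%N then 0 < q (tnth e i) else q (tnth e i) < 0].

Definition symmetric_bilinear (R : comNzRingType) (U : lmodType R)
    (b : U -> U -> R) : Prop :=
  bilinear_for *%R *%R b /\ (forall x y, b x y = b y x).

Definition symmetric_trilinear (R : comNzRingType) (U : lmodType R)
    (t : U -> U -> U -> R) : Prop :=
  [/\ forall y z, GRing.linear_for *%R (fun x => t x y z),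
      forall x y z, t x y z = t y x z
    & forall x y z, t x y z = t x z y].

(* The form [t] is determined by [t x x x = 6 N x].  That normalization forces
   the factor 1/4 in the last clause: at [x = y = 1_J] the other clauses give
   (1_J, 1_J) = 3 and (1_J, 1_J, 1_J) = 6, and 3 = 36 / 4 - 6. *)
Definition cubic_norm_structure (R : realType) (J : vectType R) (N : J -> R)
    (sharp : J -> J) (one : J) (pair : J -> J -> R) : Prop :=
  let cross := polar sharp in
  [/\ homogeneous_polynomial 3 N, quadratic_map sharp & symmetric_bilinear pair]
  /\ [/\ N one = 1,
         sharp one = one,
         forall x, cross one x = pair one x *: one - x,
         forall x, sharp (sharp x) = N x *: x
       & forall x y, N (x + y) = N x + pair (sharp x) y + pair x (sharp y) + N y]
  /\ exists t : J -> J -> J -> R,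
       [/\ symmetric_trilinear t,
           forall x, t x x x = 6 * N x
         & forall x y,
             pair x y = 4^-1 * (t one one x * t one one y) - t one x y].

Definition is_tensor_product (R : comNzRingType) (U V T : lmodType R)
    (tens : {bilinear U -> V -> T}) : Prop :=
  forall (W : lmodType R) (b : {bilinear U -> V -> W}),
    (exists h : {linear T -> W}, forall u v, h (tens u v) = b u v) /\
    (forall h h' : {linear T -> W},
       (forall u v, h (tens u v) = h' (tens u v)) -> h =1 h').

Definition freudenthal_space (R : realType) (J : vectType R) : vectType R :=
  (R^o * J * J * R^o)%type.

Definition freudenthal_symplectic (R : realType) (J : vectType R)
    (pair : J -> J -> R) (w w' : freudenthal_space J) : R :=
  let: (a, b, c, d) := w in
  let: (a', b', c', d') := w' in
  (a : R) * d' - pair b c' + pair c b' - (d : R) * a'.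

Definition freudenthal_quartic (R : realType) (J : vectType R) (N : J -> R)
    (sharp : J -> J) (pair : J -> J -> R) (w : freudenthal_space J) : R :=
  let: (a, b, c, d) := w in
  ((a : R) * d - pair b c) ^+ 2 + 4 * (a : R) * N c + 4 * (d : R) * N b
    - 4 * pair (sharp b) (sharp c).

Definition spin_factor (R : realType) (S : vectType R) : vectType R :=
  (R^o * S)%type.

Definition spin_norm (R : realType) (S : vectType R) (qS : S -> R)
    (x : spin_factor S) : R :=
  (x.1 : R) * qS x.2.

Definition spin_sharp (R : realType) (S : vectType R) (qS : S -> R)
    (iotaS : S -> S) (x : spin_factor S) : spin_factor S :=
  (qS x.2, (x.1 : R) *: iotaS x.2).

Definition spin_one (R : realType) (S : vectType R) (oneS : S) :
    spin_factor S :=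
  (1, oneS).

Definition spin_pair (R : realType) (S : vectType R) (qS : S -> R)
    (iotaS : S -> S) (x y : spin_factor S) : R :=
  (x.1 : R) * y.1 + polar qS x.2 (iotaS y.2).

Definition quadV_space (R : realType) (S : vectType R) : vectType R :=
  (R^o * S * R^o)%type.

Definition quadV (R : realType) (S : vectType R) (qS : S -> R)
    (v : quadV_space S) : R :=
  let: (a, s, b) := v in (a : R) * b - qS s.

(* Main.v *)
Require Import Defs.
From HB Require Import structures.
From mathcomp Require Import all_boot all_order all_algebra reals.
From mathcomp Require Import mpoly.
From mathcomp Require Import ring.

Set Implicit Arguments.
Unset Strict Implicit.
Unset Printing Implicit Defensive.

Import Order.TTheory GRing.Theory Num.Theory.
Local Open Scope ring_scope.

(** The vector [x - (x, 1_S)/2 1_S] is orthogonal to [1_S], so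
    [iota_S x = (x, 1_S) 1_S - x].  Hence [iota_S] is an isometry of [q_S], and
    the axioms of a cubic norm structure become polynomial identities.

    For [V_2 (x) V], the universal property gives the two coordinate maps
    [X, Y : T -> V] of the basis [e, f], with [z = e (x) X z + f (x) Y z].  In
    terms of [v = X z] and [w = Y z] the symplectic form is
    [(v, w')_V - (w, v')_V] and the quartic form is
    [(v, w)_V ^ 2 - 4 q_V(v) q_V(w)]; both are compared with Freudenthal's
    forms by expansion.  Nondegeneracy of [( , )_S], read off an orthogonal basis,
    passes to [( , )_V] and then to the symplectic form. *)

(** * Homogeneous polynomial functions on a vector space *)

Section HomogeneousPolynomial.
Variables (R : fieldType) (U : vectType R).
Implicit Types F G : U -> R.

Lemma eq_homogeneous_polynomial d F G :
  F =1 G -> homogeneous_polynomial d F -> homogeneous_polynomial d G.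
Proof. by move=> eqFG [p hp Fp]; exists p => // x; rewrite -eqFG. Qed.

Lemma homogeneous_polynomialD d F G :
  homogeneous_polynomial d F -> homogeneous_polynomial d G ->
  homogeneous_polynomial d (fun x => F x + G x).
Proof.
move=> [p hp Fp] [q hq Gq]; exists (p + q); first exact: rpredD.
by move=> x; rewrite Fp Gq mevalD.
Qed.

Lemma homogeneous_polynomialM d d' F G :
  homogeneous_polynomial d F -> homogeneous_polynomial d' G ->
  homogeneous_polynomial (d + d') (fun x => F x * G x).
Proof.
move=> [p hp Fp] [q hq Gq]; exists (p * q); first exact: dhomogM.
by move=> x; rewrite Fp Gq mevalM.
Qed.

Lemma homogeneous_polynomialZ d (a : R) F :
  homogeneous_polynomial d F -> homogeneous_polynomial d (fun x => a * F x).
Proof.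
move=> [p hp Fp]; exists (a *: p); first exact: rpredZ.
by move=> x; rewrite Fp mevalZ.
Qed.

Lemma homogeneous_linear F :
  GRing.linear_for *%R F -> homogeneous_polynomial 1 F.
Proof.
move=> linF.
(* The lemma on images of sums applies to bundled linear maps, so [F] is first packed as [F']. *)
have [F' FE] : exists F' : {scalar U}, F =1 F'.
  pose mF := GRing.isLinear.Build R U R *%R F linF.
  by exists (HB.pack_for {scalar U} F mF).
exists (\sum_(i < \dim {:U}) F (vbasis {:U})`_i *: 'X_i).
  by apply: rpred_sum => i _; apply: rpredZ; rewrite dhomogX /= mdeg1.
move=> x; rewrite FE [in LHS](coord_vbasis (memvf x)).
rewrite [LHS]linear_sum [RHS]linear_sum.
by apply: eq_bigr => i _ /=; rewrite linearZ mevalZ mevalXU FE mulrC.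
Qed.

(** The witness is the quadratic polynomial whose coefficients form the Gram matrix of [b] in the
    chosen basis. *)
Lemma homogeneous_bilinear (b : U -> U -> R) :
  bilinear_for *%R *%R b -> homogeneous_polynomial 2 (fun x => b x x).
Proof.
move=> bilb.
have [b' bE] : exists b' : {biscalar U}, forall x y, b x y = b' x y.
  pose mb := bilinear_isBilinear.Build R U U R _ _ b bilb.
  by exists (HB.pack_for {biscalar U} b mb).
pose c i j := b (vbasis {:U})`_i (vbasis {:U})`_j.
exists (\sum_(i < \dim {:U}) \sum_(j < \dim {:U}) c i j *: ('X_i * 'X_j)).
  do 2![apply: rpred_sum => ? _]; apply: rpredZ.
  by apply: (@dhomogM _ _ _ 1 _ 1); rewrite dhomogX /= mdeg1.
move=> x; rewrite bE [in LHS](coord_vbasis (memvf x)).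
rewrite linear_sumlz [RHS]linear_sum; apply: eq_bigr => i _ /=.
rewrite linear_sumr [RHS]linear_sum; apply: eq_bigr => j _ /=.
by rewrite linearZlr /c bE mevalZ mevalM !mevalXU [LHS]mulrA [LHS]mulrC.
Qed.

End HomogeneousPolynomial.

(** * Quadratic forms and their polar forms *)

Lemma polarC (U V : zmodType) (q : U -> V) x y : polar q x y = polar q y x.
Proof. by rewrite /polar [y + x]addrC addrAC. Qed.

Section QuadraticForm.
Variables (R : numFieldType) (U : vectType R) (q : U -> R).
Hypothesis quadq : quadratic_map (q : U -> R^o).

Lemma quadraticZ a x : q (a *: x) = a ^+ 2 * q x.
Proof. exact: quadq.1. Qed.

Lemma quadraticN x : q (- x) = q x.
Proof. by rewrite -scaleN1r quadraticZ sqrrN expr1n mul1r. Qed.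

Lemma quadraticD x y : q (x + y) = q x + q y + polar q x y.
Proof. by rewrite /polar; ring. Qed.

Lemma polarPl a x y z :
  polar q (a *: x + y) z = a * polar q x z + polar q y z.
Proof. exact: (quadq.2.1 z a). Qed.

Lemma polarPr a x y z :
  polar q z (a *: x + y) = a * polar q z x + polar q z y.
Proof. exact: (quadq.2.2 z a). Qed.

Lemma polarDl x y z : polar q (x + y) z = polar q x z + polar q y z.
Proof. by have := polarPl 1 x y z; rewrite scale1r mul1r. Qed.

Lemma polarDr x y z : polar q z (x + y) = polar q z x + polar q z y.
Proof. by rewrite !(polarC _ z) polarDl. Qed.

Lemma polar0l z : polar q 0 z = 0.
Proof. by apply: (@addrI _ (polar q 0 z)); rewrite -polarDl !addr0. Qed.

Lemma polarZl a x z : polar q (a *: x) z = a * polar q x z.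
Proof. by have := polarPl a x 0 z; rewrite polar0l !addr0. Qed.

Lemma polarZr a x z : polar q z (a *: x) = a * polar q z x.
Proof. by rewrite !(polarC _ z) polarZl. Qed.

Lemma polarNl x z : polar q (- x) z = - polar q x z.
Proof. by rewrite -scaleN1r polarZl mulN1r. Qed.

Lemma polarNr x z : polar q z (- x) = - polar q z x.
Proof. by rewrite !(polarC _ z) polarNl. Qed.

Lemma polarxx x : polar q x x = 2 * q x.
Proof.
by rewrite /polar -[in x + x](scale1r x) -scalerDl quadraticZ; ring.
Qed.

Lemma homogeneous_polar (T : vectType R) (f g : {linear T -> U}) :
  homogeneous_polynomial 2 (fun x => polar q (f x) (g x)).
Proof.
apply: (@homogeneous_bilinear _ _ (fun x y => polar q (f x) (g y))).
by split=> z a x y /=; rewrite linearP ?polarPl ?polarPr.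
Qed.

(** Since 2 is invertible, [q] is half the diagonal of its polar form, which is bilinear. *)
Lemma homogeneous_quadratic (T : vectType R) (f : {linear T -> U}) :
  homogeneous_polynomial 2 (fun x => q (f x)).
Proof.
have := homogeneous_polynomialZ 2^-1 (homogeneous_polar f f).
apply: eq_homogeneous_polynomial => x.
by rewrite polarxx mulKf ?pnatr_eq0.
Qed.

End QuadraticForm.

(** Pairing [x] with the basis vector e_i leaves only 2 q(e_i) times the i-th coordinate of [x], and
    q(e_i) is nonzero because it has a strict sign. *)
Lemma has_signature_nondegenerate (R : realType) (U : vectType R)
    (q : U -> R) p n :
  quadratic_map (q : U -> R^o) -> has_signature q p n ->
  forall x, (forall y, polar q x y = 0) -> x = 0.
Proof.
move=> quadq [e [basis_e orth_e sgn_e]] x x_rad.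
rewrite [x](coord_basis basis_e (memvf x)) big1 // => i _.
suff -> : coord e i x = 0 by rewrite scale0r.
have /eqP := x_rad (tnth e i).
rewrite [x in polar _ x](coord_basis basis_e (memvf x)).
have polar_sum (F : 'I_(p + n) -> U) y :
    polar q (\sum_j F j) y = \sum_j polar q (F j) y.
  by elim/big_ind2: _ => [|_ a _ b <- <-|//]; rewrite (polar0l, polarDl).
rewrite polar_sum (bigD1 i) //= big1 => [|j ji]; last first.
  by rewrite polarZl // -tnth_nth orth_e ?mulr0.
have /negPf q_neq0 : q (tnth e i) != 0.
  by have := sgn_e i; case: ifP => _ => [/gt_eqF|/lt_eqF] ->.
rewrite addr0 polarZl // -tnth_nth polarxx // !mulf_eq0 pnatr_eq0 q_neq0 /=.
by rewrite orbF => /eqP.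
Qed.

(** * Coordinates on a tensor product from its universal property *)

Section TensorCoordinates.
Variables (R : fieldType) (n : nat) (U V T : vectType R).
Variables (tens : {bilinear U -> V -> T}) (X : n.-tuple U).
Hypotheses (tensP : is_tensor_product tens) (basisX : basis_of {:U} X).

(** This is the existence half of the universal property, applied to the bilinear map sending (u, v)
    to the i-th coordinate of u times v. *)
Lemma tensor_coordinate (i : 'I_n) :
  exists P : {linear T -> V}, forall u v, P (tens u v) = coord X i u *: v.
Proof.
pose b u v := coord X i u *: (v : V).
have bilb : bilinear_for *:%R *:%R b.
  split=> z a x y; rewrite /b.
    by rewrite linearP scalerDl -scalerA.
  by rewrite scalerDr /= !scalerA [_ * a]mulrC.
pose b' : {bilinear U -> V -> V} :=
  HB.pack b (bilinear_isBilinear.Build R U V V _ _ b bilb).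
by have [[P PE] _] := tensP b'; exists P => u v; rewrite PE.
Qed.

Lemma tensor_coordinates (P : 'I_n -> {linear T -> V}) :
  (forall i u v, P i (tens u v) = coord X i u *: v) ->
  forall z, z = \sum_(i < n) tens X`_i (P i z).
Proof.
move=> PE.
have lin_s : linear (fun z => \sum_(i < n) tens X`_i (P i z)).
  move=> a x y; rewrite scaler_sumr -big_split /=; apply: eq_bigr => i _.
  by rewrite linearP linearPr.
pose s : {linear T -> T} := HB.pack (fun z => \sum_(i < n) tens X`_i (P i z))
  (GRing.isLinear.Build _ _ _ _ _ lin_s).
(* Uniqueness for the bilinear map [tens] itself: the identity and [s] are both linear, so agreement
   on pure tensors suffices. *)
have [_ /(_ idfun s) idE] := tensP tens.
apply: idE => u v /=; rewrite {1}(coord_basis basisX (memvf u)) linear_sumlz.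
by apply: eq_bigr => i _; rewrite PE linearZl_LR linearZr_LR.
Qed.

End TensorCoordinates.

(* Both members of the pairs in [spin_factor S] and [quadV_space S] live in
   lmodules, so a scalar entry is multiplied by [*:] in [R^o]; [ring] needs the
   underlying product. *)
Lemma scale_regular (R : pzRingType) (a : R) (x : R^o) : a *: x = a * x.
Proof. by []. Qed.

(** * The cubic norm structure on the spin factor *)

Section SpinFactor.
Variables (R : realType) (S : vectType R) (q : S -> R).
Variables (one : S) (iota : {linear S -> S}).
Hypotheses (quadq : quadratic_map (q : S -> R^o)) (q_one : q one = 1).
Hypotheses (iotaK : involutive iota) (iota_one : iota one = one).
Hypothesis iotaN : forall x, polar q x one = 0 -> iota x = - x.

Lemma spin_iotaE x : iota x = polar q x one *: one - x.
Proof.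
have b11 : polar q one one = 2 by rewrite polarxx // q_one mulr1.
pose y := x - (polar q x one / 2) *: one.
have /iotaN iotay : polar q y one = 0.
  by rewrite /y polarDl // polarNl // polarZl // b11 divfK ?pnatr_eq0 ?subrr.
rewrite -[in LHS](subrK ((polar q x one / 2) *: one) x) -/y.
rewrite linearD iotay linearZ /=.
by rewrite iota_one /y opprB addrC addrA -scalerDl -splitr.
Qed.

Lemma spin_q_iota x : q (iota x) = q x.
Proof.
rewrite spin_iotaE quadraticD quadraticZ // quadraticN // polarNr // polarZl //.
by rewrite q_one (polarC q one); ring.
Qed.

Lemma spin_polar_iota x y : polar q (iota x) (iota y) = polar q x y.
Proof. by rewrite /polar -linearD !spin_q_iota. Qed.

(** An involutive isometry is self-adjoint; this is what makes [spin_pair] symmetric. *)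
Lemma spin_polar_iotal x y : polar q (iota x) y = polar q x (iota y).
Proof. by rewrite -{1}(iotaK y) spin_polar_iota. Qed.

Lemma spin_pair_bilinear : symmetric_bilinear (spin_pair q iota).
Proof.
split; last first.
  by move=> x y; rewrite /spin_pair mulrC polarC spin_polar_iotal.
by split=> z a x y;
  rewrite /spin_pair /= ?linearP ?polarPl ?polarPr //= scale_regular; ring.
Qed.

(** The full polarization of [spin_norm]: on the diagonal each of the three terms is 2 N(x), which
    gives the required 6 N(x). *)
Definition spin_trilinear (x y z : spin_factor S) : R :=
  (x.1 : R) * polar q y.2 z.2 + (y.1 : R) * polar q x.2 z.2 +
  (z.1 : R) * polar q x.2 y.2.

Lemma spin_sharp_polarE x y :
  polar (spin_sharp q iota) x y =
  (polar q x.2 y.2, (x.1 : R) *: iota y.2 + (y.1 : R) *: iota x.2).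
Proof.
case: x y => [x1 x2] [y1 y2]; congr (_, _) => //=.
rewrite linearD scalerDr !scalerDl !addrA [LHS]addrAC addrK.
by rewrite [LHS]addrAC [X in X - _]addrC addrK addrC.
Qed.

Lemma spin_cubic_norm_structure :
  cubic_norm_structure (spin_norm q) (spin_sharp q iota) (spin_one one)
    (spin_pair q iota).
Proof.
split; last split.
- split; last exact: spin_pair_bilinear.
    apply: (@homogeneous_polynomialM _ _ 1 2 (fun x : spin_factor S => x.1)).
      exact: homogeneous_linear.
    exact: (homogeneous_quadratic quadq (snd : {linear _ -> S})).
  split=> [a [x1 x2]|].
    congr (_, _) => /=; first by rewrite quadraticZ.
    by rewrite linearZ /= !scalerA scale_regular mulrAC expr2.
  (* The polar map is symmetric, so linearity in one argument gives bilinearity. *)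
  suff polarP z : linear (fun x => polar (spin_sharp q iota) x z).
    by split=> // z a x y; rewrite !(polarC _ z) polarP.
  move=> a x y; rewrite !spin_sharp_polarE; congr (_, _) => /=.
    by rewrite polarPl.
  rewrite linearP /= scale_regular scalerDr scalerDl !scalerDr !scalerA.
  by rewrite (mulrC z.1) addrACA.
- split.
  + by rewrite /spin_norm q_one mulr1.
  + by rewrite /spin_sharp /spin_one /= q_one iota_one scale1r.
  + move=> [x1 x2]; rewrite spin_sharp_polarE /spin_pair; congr (_, _) => /=.
      rewrite mul1r -spin_polar_iotal iota_one scale_regular; ring.
    rewrite mul1r -spin_polar_iotal iota_one spin_iotaE scale1r polarC.
    by rewrite addrC addrA -scalerDl.
  + move=> [x1 x2]; congr (_, _) => /=.
      by rewrite quadraticZ // spin_q_iota scale_regular [RHS]mulrAC expr2.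
    by rewrite linearZ /= iotaK scalerA /spin_norm mulrC.
  + move=> [x1 x2] [y1 y2]; rewrite /spin_norm /spin_pair /= linearZ /=.
    by rewrite quadraticD polarZl // polarZr // iotaK spin_polar_iota; ring.
- exists spin_trilinear; split; first split.
  + move=> y z a x y'.
    by rewrite /spin_trilinear /= !polarPl // scale_regular; ring.
  + by move=> x y z; rewrite /spin_trilinear (polarC q x.2 y.2); ring.
  + by move=> x y z; rewrite /spin_trilinear (polarC q y.2 z.2); ring.
  + by move=> x; rewrite /spin_trilinear /spin_norm polarxx //; ring.
  (* Here (1_J, 1_J, x) = 2 (x.1 + (1_S, x.2)_S), so the factor 1/4 cancels the two 2s. Subtracting
     (1_J, x, y) removes the mixed terms and leaves x.1 y.1 + (1_S, x.2)_S (1_S, y.2)_S - (x.2,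
     y.2)_S. *)
  + move=> x y; rewrite /spin_trilinear /spin_pair /= spin_iotaE.
    rewrite polarDr // polarNr // polarZr // polarxx // q_one.
    by rewrite !(polarC q one); field.
Qed.

(** * The quadratic space V and the comparison with Freudenthal's forms *)

Implicit Types v w : quadV_space S.

Lemma quadV_polarE v w :
  polar (quadV q) v w =
  (v.1.1 : R) * w.2 + (v.2 : R) * w.1.1 - polar q v.1.2 w.1.2.
Proof.
case: v w => [[a s] a'] [[c t] c'].
by rewrite /polar /quadV /= -/(polar q s t) quadraticD; ring.
Qed.

Lemma quadV_quadratic : quadratic_map (quadV q : quadV_space S -> R^o).
Proof.
split=> [a [[c s] d]|].
  by rewrite /quadV /= quadraticZ // !scale_regular; ring.
suff polarP w : linear (fun v => polar (quadV q) v w : R^o).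
  by split=> // w a v v'; rewrite !(polarC _ w) polarP.
by move=> a x y; rewrite !quadV_polarE /= polarPl // !scale_regular; ring.
Qed.

Lemma quadV_nondegenerate :
  (forall x, (forall y, polar q x y = 0) -> x = 0) ->
  forall v, (forall w, polar (quadV q) v w = 0) -> v = 0.
Proof.
move=> q_nondeg [[a s] b] v_rad.
have /q_nondeg -> : forall t, polar q s t = 0.
  move=> t; have := v_rad (0, t, 0).
  by rewrite quadV_polarE /= !mulr0 !add0r => /eqP; rewrite oppr_eq0 => /eqP.
(* The two isotropic ends form a hyperbolic pair, so each test vector reads off the opposite scalar
   coordinate. *)
have := v_rad (1, 0, 0); have := v_rad (0, 0, 1); rewrite !quadV_polarE /=.
rewrite !(polarC q _ 0) !polar0l // !(mulr0, mulr1, add0r, addr0, subr0).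
by move=> -> ->.
Qed.

Definition spin_freudenthal v w : freudenthal_space (spin_factor S) :=
  (v.1.1, (w.1.1, v.1.2), (v.2, iota w.1.2), w.2).

Definition spin_freudenthal_e (z : freudenthal_space (spin_factor S)) :
    quadV_space S :=
  (z.1.1.1, z.1.1.2.2, z.1.2.1).

(** The same [iota] serves for the inverse, being an involution. *)
Definition spin_freudenthal_f (z : freudenthal_space (spin_factor S)) :
    quadV_space S :=
  (z.1.1.2.1, iota z.1.2.2, z.2).

Lemma spin_freudenthalK z :
  spin_freudenthal (spin_freudenthal_e z) (spin_freudenthal_f z) = z.
Proof.
by case: z => [[[a [c s]] [b t]] d]; rewrite /spin_freudenthal /= iotaK.
Qed.

Lemma spin_freudenthal_eK v w : spin_freudenthal_e (spin_freudenthal v w) = v.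
Proof. by case: v w => [[a s] b] [[c t] d]. Qed.

Lemma spin_freudenthal_fK v w : spin_freudenthal_f (spin_freudenthal v w) = w.
Proof.
by case: v w => [[a s] b] [[c t] d]; rewrite /spin_freudenthal_f /= iotaK.
Qed.

Lemma freudenthal_symplectic_spin v w v' w' :
  freudenthal_symplectic (spin_pair q iota)
    (spin_freudenthal v w) (spin_freudenthal v' w') =
  polar (quadV q) v w' - polar (quadV q) w v'.
Proof.
rewrite !quadV_polarE /= /spin_pair /= !spin_polar_iotal !iotaK.
by rewrite (polarC q w.1.2); ring.
Qed.

(** For v = (a, s, b) and w = (c, t, d), the squares use ad + bc - (s, t)_S on V and ad - bc - (s,
    t)_S on W_J. They differ by 4abcd - 4bc (s, t)_S: the first term comes from 4 q_V(v) q_V(w), the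
    second from the pairing of the two sharps. *)
Lemma freudenthal_quartic_spin v w :
  freudenthal_quartic (spin_norm q) (spin_sharp q iota) (spin_pair q iota)
    (spin_freudenthal v w) =
  polar (quadV q) v w ^+ 2 - 4 * quadV q v * quadV q w.
Proof.
case: v w => [[a s] b] [[c t] d]; rewrite quadV_polarE /quadV /=.
rewrite /spin_norm /spin_pair /= iotaK spin_q_iota.
by rewrite linearZ polarZl // polarZr // spin_polar_iota; ring.
Qed.

End SpinFactor.

(** * Skew-symmetric forms and the transfer to the tensor product *)

Lemma skew_symmetric_of (R : comNzRingType) (T : lmodType R) (w : T -> T -> R) :
  bilinear_for *%R *%R w -> (forall x y, w x y = - w y x) ->
  exists omega : {skew_symmetric T}, forall x y, omega x y = w x y.
Proof.
move=> bilw skew_w.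
pose mb := bilinear_isBilinear.Build R T T R *%R (idfun \; *%R) w bilw.
(* A skew-symmetric form is a Hermitian form with trivial conjugation [idfun] whose sign exponent is
   the boolean [true], read as 1. *)
have skew_w' x y : w x y = (-1) ^+ true * idfun (w y x).
  by rewrite expr1 mulN1r skew_w.
pose ms := isHermitianSesquilinear.Build R T true idfun w skew_w'.
by exists (HB.pack_for {skew_symmetric T} w mb ms).
Qed.

Theorem theoremA1 (R : realType) (r : nat) (S : vectType R) (qS : S -> R)
    (oneS : S) (iotaS : {linear S -> S}) :
  quadratic_map (qS : S -> R^o) ->
  has_signature qS 1 r ->
  qS oneS = 1 ->
  involutive iotaS ->
  iotaS oneS = oneS ->
  (forall x : S, polar qS x oneS = 0 -> iotaS x = - x) ->
  let N := spin_norm qS in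
  let sharp := spin_sharp qS iotaS in
  let pair := spin_pair qS iotaS in
  let qV := quadV qS in
  cubic_norm_structure N sharp (spin_one oneS) pair
  /\
  forall (V2 : vectType R) (e f : V2) (omega2 : {skew_symmetric V2})
         (T : vectType R) (tens : {bilinear V2 -> quadV_space S -> T}),
    basis_of {:V2} [:: e; f] ->
    is_psymplectic omega2 ->
    omega2 e f = 1 ->
    is_tensor_product tens ->
    exists phi : {linear T -> freudenthal_space (spin_factor S)},
      [/\ bijective phi,
          forall (a b c d : R) (s t : S),
            phi (tens e (a, s, b) + tens f (c, t, d))
              = (a, (c, s), (b, iotaS t), d),
          (exists omega : {skew_symmetric T},
             [/\ is_psymplectic omega,
                 forall v v' x x',
                   omega (tens v x) (tens v' x') = omega2 v v' * polar qV x x'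
               & forall z z',
                   omega z z' = freudenthal_symplectic pair (phi z) (phi z')])
        & (exists Q : T -> R,
             [/\ homogeneous_polynomial 4 Q,
                 forall x y,
                   Q (tens e x + tens f y)
                     = polar qV x y ^+ 2 - 4 * qV x * qV y
               & forall z, Q z = freudenthal_quartic N sharp pair (phi z)])].
Proof.
move=> quadq sign_q q_one iotaK iota_one iotaN N sharp pair qV.
split; first exact: spin_cubic_norm_structure.
move=> V2 e f omega2 T tens basis_ef _ omega_ef tensP.
pose ef : 2.-tuple V2 := [tuple e; f].
have free_ef : free ef := basis_free basis_ef.
have [X XE] := tensor_coordinate ef tensP ord0.
have [Y YE] := tensor_coordinate ef tensP (lift ord0 ord0).
pose ve v := coord ef ord0 v; pose vf v := coord ef (lift ord0 ord0) v.
have coordE v : v = ve v *: e + vf v *: f.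
  by rewrite [LHS](coord_basis basis_ef (memvf v)) big_ord_recl big_ord1.
have zE z : z = tens e (X z) + tens f (Y z).
  pose P (i : 'I_2) := if i == ord0 then X else Y.
  have := tensor_coordinates tensP basis_ef (P := P).
  move=> /(_ _ z); rewrite big_ord_recl big_ord1; apply=> i u v.
  rewrite /P; case: (unliftP ord0 i) => [j|] -> //=; rewrite ?XE ?YE //.
  by rewrite [j]ord1.
have [ve_e vf_e] : ve e = 1 /\ vf e = 0.
  split; first exact: (coord_free ord0 ord0).
  exact: (coord_free ord0 (lift ord0 ord0)).
have [ve_f vf_f] : ve f = 0 /\ vf f = 1.
  split; [exact: (coord_free (lift ord0 ord0) ord0)|].
  exact: (coord_free (lift ord0 ord0) (lift ord0 ord0)).
have X_ef x y : X (tens e x + tens f y) = x.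
  by rewrite linearD !XE -!/(ve _) ve_e ve_f scale1r scale0r addr0.
have Y_ef x y : Y (tens e x + tens f y) = y.
  by rewrite linearD !YE -!/(vf _) vf_e vf_f scale1r scale0r add0r.
have quadV_q : quadratic_map (qV : _ -> R^o) by exact: quadV_quadratic.
pose phi0 z := spin_freudenthal iotaS (X z) (Y z).
have lin_phi : linear phi0.
  by move=> a z z'; rewrite /phi0 /spin_freudenthal !linearP.
pose phi := HB.pack_for {linear T -> freudenthal_space (spin_factor S)} phi0
  (GRing.isLinear.Build _ _ _ _ _ lin_phi).
exists phi; split.
- exists (fun w => tens e (spin_freudenthal_e w)
                   + tens f (spin_freudenthal_f iotaS w)) => z /=.
    by rewrite /phi0 spin_freudenthal_eK spin_freudenthal_fK // -zE.
  by rewrite /phi0 X_ef Y_ef spin_freudenthalK.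
- by move=> a b c d s t /=; rewrite /phi0 X_ef Y_ef.
- pose w z z' := polar qV (X z) (Y z') - polar qV (Y z) (X z').
  have [||omega omegaE] := @skew_symmetric_of _ _ w.
  + by split=> z a x y; rewrite /w !linearP ?polarPl ?polarPr //=; ring.
  + by move=> z z'; rewrite /w [RHS]opprB (polarC qV (X z)) (polarC qV (Y z)).
  exists omega; split.
  + split; first last.
    * by rewrite pchar_num.
    * by [].
    apply/eqP/vspaceP => z; rewrite memv0.
    apply/idP/eqP => [|->]; last exact: mem0v.
    move=> /mem_orthovP z_rad.
    (* Taking [x] zero isolates the pairing of [X z] with [y], and taking [y] zero that of [Y z]
       with [x]; nondegeneracy on V then kills both coordinates. *)
    have w_rad x y : w z (tens e x + tens f y) = 0.
      by rewrite -omegaE; apply: z_rad; rewrite memvf.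
    rewrite (zE z).
    have qS_nondeg := has_signature_nondegenerate quadq sign_q.
    have qV_nondeg := quadV_nondegenerate quadq qS_nondeg.
    have -> : X z = 0.
      apply: qV_nondeg => y; have := w_rad 0 y.
      by rewrite /w X_ef Y_ef (polarC qV _ 0) polar0l // subr0.
    have -> : Y z = 0.
      apply: qV_nondeg => x; have := w_rad x 0.
      rewrite /w X_ef Y_ef (polarC qV _ 0) polar0l // sub0r => /eqP.
      by rewrite oppr_eq0 => /eqP.
    by rewrite !linear0r addr0.
  + move=> v v' x x'; rewrite omegaE /w !XE !YE -!/(ve _) -!/(vf _).
    have omegaC : omega2 f e = - 1 by rewrite hermC expr1 mulN1r omega_ef.
    have omegaxx u : omega2 u u = 0.
      apply/eqP; have /eqP := hermC omega2 u u.
      by rewrite expr1 mulN1r -addr_eq0 -mulr2n mulrn_eq0.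
    (* In the basis [e], [f] the form [omega2] is the 2 by 2 determinant of coordinates. *)
    have -> : omega2 v v' = ve v * vf v' - vf v * ve v'.
      rewrite [in LHS](coordE v) [in LHS](coordE v') linearDl !linearDr.
      rewrite !linearZl_LR !linearZr_LR /= !omegaxx omegaC omega_ef; ring.
    by rewrite !polarZl // !polarZr //; ring.
  + by move=> z z'; rewrite omegaE (freudenthal_symplectic_spin quadq q_one).
- exists (fun z => polar qV (X z) (Y z) ^+ 2 - 4 * qV (X z) * qV (Y z)); split.
  (* Both terms are products of two quadratic functions of z, since [X] and [Y] are linear; hence
     degree 2 + 2. *)
  + have hXY := homogeneous_polar quadV_q X Y.
    have hX := homogeneous_quadratic quadV_q X.
    have hY := homogeneous_quadratic quadV_q Y.
    have := homogeneous_polynomialD (homogeneous_polynomialM hXY hXY)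
      (homogeneous_polynomialZ (- 4) (homogeneous_polynomialM hX hY)).
    by apply: eq_homogeneous_polynomial => z; rewrite expr2 mulNr mulrA.
  + by move=> x y; rewrite X_ef Y_ef.
  + by move=> z; rewrite (freudenthal_quartic_spin quadq q_one).
Qed.
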